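(* For every $n\ge 3$ there exist a domain $D\subset\mathbb{R}^n$ and a smooth $1$-QC embedding $f:D\to\mathbb{R}^{n+1}$ which is not Möbius, i.e. which is not the restriction to $D$ (with $\mathbb{R}^n$ identified with $\mathbb{R}^n\times\{0\}\subset\mathbb{R}^{n+1}$) of a Möbius transformation of $\overline{\mathbb{R}}^{n+1}=\mathbb{R}^{n+1}\cup\{\infty\}$.
   Context: An embedding $f:D\to\mathbb{R}^{n+1}$ is $1$-QC ($1$-quasiconformal) if for all $x\in D$ $$\limsup_{r\to 0}\frac{\sup\{|f(x)-f(y)|: |x-y|=r\}}{\inf\{|f(x)-f(y)|: |x-y|=r\}}\le 1.$$ A Möbius transformation is a finite composition of reflections in spheres or hyperplanes. *)

(* Defs.v *)
From HB Require Import structures.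
From mathcomp Require Import all_boot all_order all_algebra.
From mathcomp Require Import all_classical all_reals all_analysis.

Set Implicit Arguments.
Unset Strict Implicit.
Unset Printing Implicit Defensive.

Import Order.TTheory GRing.Theory Num.Theory.
Import numFieldNormedType.Exports.

Local Open Scope classical_set_scope.
Local Open Scope ring_scope.

(* R^n is 'rV[R]_n. The library's norm on 'rV[R]_n is the sup norm: it provides
   the usual topology and derivatives, but every metric notion below has to use
   the Euclidean norm [enorm] instead. *)

Definition dot (R : realType) (n : nat) (x y : 'rV[R]_n) : R :=
  \sum_(i < n) x 0 i * y 0 i.

Definition enorm (R : realType) (n : nat) (x : 'rV[R]_n) : R :=
  Num.sqrt (dot x x).

Definition domain (R : realType) (n : nat) (D : set 'rV[R]_n) : Prop :=
  [/\ open D, connected D & D !=set0].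

(* A map D -> R^m is represented by a total function, all of whose properties
   below only depend on its values on (the open set) D. *)

Definition embedding (R : realType) (n m : nat) (D : set 'rV[R]_n)
    (f : 'rV[R]_n -> 'rV[R]_m) : Prop :=
  {within D, continuous f} /\
  exists g : 'rV[R]_m -> 'rV[R]_n,
    {within f @` D, continuous g} /\ forall x, D x -> g (f x) = x.

Fixpoint iter_partial (R : realType) (n m : nat) (s : seq 'I_n)
    (f : 'rV[R]_n -> 'rV[R]_m) : 'rV[R]_n -> 'rV[R]_m :=
  if s is i :: s' then fun x => 'D_(delta_mx 0 i) (iter_partial s' f) x else f.

(* C^oo: the partial derivatives of all orders exist and are continuous on D. *)
Definition smooth (R : realType) (n m : nat) (D : set 'rV[R]_n)
    (f : 'rV[R]_n -> 'rV[R]_m) : Prop :=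
  forall (s : seq 'I_n) (x : 'rV[R]_n), D x ->
    {for x, continuous (iter_partial s f)} /\
    forall i : 'I_n, derivable (iter_partial s f) x (delta_mx 0 i).

Definition smooth_embedding (R : realType) (n m : nat) (D : set 'rV[R]_n)
    (f : 'rV[R]_n -> 'rV[R]_m) : Prop :=
  [/\ embedding D f, smooth D f
    & forall x, D x -> differentiable f x /\ injective ('d f x)].

Definition dist_on_sphere (R : realType) (n m : nat) (D : set 'rV[R]_n)
    (f : 'rV[R]_n -> 'rV[R]_m) (x : 'rV[R]_n) (r : R) : set (\bar R) :=
  [set (enorm (f x - f y))%:E | y in [set y | D y /\ enorm (x - y) = r]].

(* The supremum, infimum, quotient and limsup are those of the extended reals,
   so no boundedness has to be assumed for them to make sense. For D open and f
   an embedding, the sup and the inf are positive and finite for small r > 0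
   (when n > 0). *)
Definition one_quasiconformal (R : realType) (n m : nat) (D : set 'rV[R]_n)
    (f : 'rV[R]_n -> 'rV[R]_m) : Prop :=
  forall x, D x ->
    (limf_esup (fun r : R => ereal_sup (dist_on_sphere D f x r) /
                             ereal_inf (dist_on_sphere D f x r)) (0 : R)^'+
     <= 1)%E.

(* Reflection (inversion) in the sphere of centre a and radius r, acting on
   R^n with the point at infinity [None] added. *)
Definition sphere_reflection (R : realType) (n : nat) (a : 'rV[R]_n) (r : R)
    (p : one_point_compactification 'rV[R]_n) :
    one_point_compactification 'rV[R]_n :=
  if p is Some x then
    if x == a then None
    else Some (a + (r ^+ 2 / enorm (x - a) ^+ 2) *: (x - a))
  else Some a.

(* Reflection in the hyperplane {x | dot x a = t}. *)
Definition hyperplane_reflection (R : realType) (n : nat) (a : 'rV[R]_n) (t : R)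
    (p : one_point_compactification 'rV[R]_n) :
    one_point_compactification 'rV[R]_n :=
  if p is Some x then Some (x - (2 * (dot x a - t) / enorm a ^+ 2) *: a)
  else None.

Inductive mobius (R : realType) (n : nat) :
    (one_point_compactification 'rV[R]_n ->
     one_point_compactification 'rV[R]_n) -> Prop :=
| mobius_id : mobius id
| mobius_sphere a r phi :
    0 < r -> mobius phi -> mobius (sphere_reflection a r \o phi)
| mobius_hyperplane a t phi :
    a != 0 -> mobius phi -> mobius (hyperplane_reflection a t \o phi).

Definition restriction_of_mobius (R : realType) (n : nat) (D : set 'rV[R]_n)
    (f : 'rV[R]_n -> 'rV[R]_(n + 1)) : Prop :=
  exists phi, mobius phi /\
    forall x, D x -> phi (Some (row_mx x (0 : 'rV[R]_1))) = Some (f x).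

(* Main.v *)
From HB Require Import structures.
Require Import Defs.
From mathcomp Require Import all_boot all_order all_algebra.
From mathcomp Require Import all_classical all_reals all_analysis.
From mathcomp Require Import ring lra.

(** The counterexample is a rolled-up slab: let [i0] be a coordinate and let the
    cylinder map send [x] to [(y, cos (x i0))], where [y] is [x] with its
    coordinate [x i0] replaced by [sin (x i0)]. On the slab
    [|x i0| < pi / 2] it is a smooth embedding onto an open piece of the
    cylinder [S^1 x R^(n-1)].

    It is 1-quasiconformal because it is a local isometry: it replaces only the
    contribution [(s - t) ^+ 2] of the coordinate [i0] to a squared distance by
    the squared length [4 * sin ((s - t) / 2) ^+ 2] of a chord of the unit
    circle, so that
    [|x - y| (1 - |x - y| ^+ 2 / 4) <= |f x - f y| <= |x - y|]
    for [|x - y| <= 2] ([enorm_cylinderB_le] and [enorm_cylinderB_ge]), and the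
    quotient of the supremum by the infimum over [|x - y| = r] is at most
    [(1 - r ^+ 2 / 4)^-1].

    It is not Moebius because reflections map generalized spheres
    [A |x| ^+ 2 + <b, x> + c = 0] with [(A, b, c) != 0] into generalized spheres
    of the same kind ([quadric_mobius]). A Moebius transformation extending the
    cylinder map would map the hyperplane [R^n x {0}] into such a set, and
    evaluating its equation at a few points of the cylinder forces
    [A = 0], [b = 0] and [c = 0] ([cylinder_not_in_quadric]). This needs a second
    coordinate, in which the cylinder is straight. *)

Set Implicit Arguments.
Unset Strict Implicit.
Unset Printing Implicit Defensive.

Import Order.TTheory GRing.Theory Num.Theory.
Import numFieldNormedType.Exports.

Local Open Scope classical_set_scope.
Local Open Scope ring_scope.

(** * The Euclidean inner product *)

Section Dot.
Variables (R : realType) (n : nat).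
Implicit Types (x y z : 'rV[R]_n) (c : R).

Lemma dotC x y : dot x y = dot y x.
Proof. by apply: eq_bigr => i _; rewrite mulrC. Qed.

Lemma dotDl x y z : dot (x + y) z = dot x z + dot y z.
Proof. by rewrite -big_split; apply: eq_bigr => i _; rewrite mxE mulrDl. Qed.

Lemma dotZl c x y : dot (c *: x) y = c * dot x y.
Proof. by rewrite /dot mulr_sumr; apply: eq_bigr => i _; rewrite mxE mulrA. Qed.

Lemma dotNl x y : dot (- x) y = - dot x y.
Proof. by rewrite -scaleN1r dotZl mulN1r. Qed.

Lemma dotDr x y z : dot z (x + y) = dot z x + dot z y.
Proof. by rewrite dotC dotDl !(dotC z). Qed.

Lemma dotZr c x y : dot y (c *: x) = c * dot y x.
Proof. by rewrite dotC dotZl (dotC y). Qed.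

Lemma dotNr x y : dot y (- x) = - dot y x.
Proof. by rewrite dotC dotNl (dotC y). Qed.

Definition dotE := (dotDl, dotDr, dotNl, dotNr, dotZl, dotZr).

Lemma dot0l x : dot 0 x = 0.
Proof. by rewrite /dot big1 // => i _; rewrite mxE mul0r. Qed.

Lemma dot_delta x i : dot x (delta_mx 0 i) = x 0 i.
Proof.
rewrite /dot (bigD1 i) //= mxE !eqxx mulr1 big1 ?addr0 // => j /negPf ji.
by rewrite mxE ji mulr0.
Qed.

Lemma dot_add_delta x c i : let y := x + c *: delta_mx 0 i in
  dot y y = dot x x + 2 * c * x 0 i + c ^+ 2.
Proof.
rewrite /= !dotE (dotC (delta_mx _ _) x) !dot_delta mxE !eqxx /=; ring.
Qed.

Lemma dot_ge0 x : 0 <= dot x x.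
Proof. by apply: sumr_ge0 => i _; exact: sqr_ge0. Qed.

Lemma dot_eq0 x : (dot x x == 0) = (x == 0).
Proof.
apply/idP/eqP => [|->]; last by rewrite dot0l.
rewrite psumr_eq0 => [/allP x0|i _]; last exact: sqr_ge0.
apply/rowP => i; rewrite mxE; apply/eqP; rewrite -[_ == 0]sqrf_eq0.
by apply: x0; rewrite mem_index_enum.
Qed.

Lemma sqr_coord_le x i : x 0 i ^+ 2 <= dot x x.
Proof.
rewrite /dot (bigD1 i) //= lerDl; apply: sumr_ge0 => j _; exact: sqr_ge0.
Qed.

Lemma sqr_enorm x : enorm x ^+ 2 = dot x x.
Proof. by rewrite sqr_sqrtr // dot_ge0. Qed.

Lemma enorm_ge0 x : 0 <= enorm x.
Proof. exact: sqrtr_ge0. Qed.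

End Dot.

Lemma dot_row_mx (R : realType) n m (x y : 'rV[R]_n) (z t : 'rV[R]_m) :
  dot (row_mx x z) (row_mx y t) = dot x y + dot z t.
Proof.
rewrite /dot big_split_ord; congr (_ + _); apply: eq_bigr => i _.
  by rewrite !row_mxEl.
by rewrite !row_mxEr.
Qed.

Lemma dot_scalar_mx (R : realType) (a b : R) :
  dot (a%:M : 'rV[R]_1) b%:M = a * b.
Proof. by rewrite /dot big_ord1 !mxE. Qed.

(** * Moebius transformations preserve generalized spheres *)

Section Quadric.
Variables (R : realType) (n : nat).
Implicit Types (x b : 'rV[R]_n) (p : one_point_compactification 'rV[R]_n).

(** The generalized sphere [A |x| ^+ 2 + <b, x> + c = 0] given by the triple
    [q = (A, b, c)]. The point at infinity belongs to it when [A = 0]; such a [q]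
    is a hyperplane when [b != 0]. Degenerate triples (points, the empty set) are
    kept: only [q = 0], whose locus is everything, has to be excluded. *)
Definition on_quadric (q : R * 'rV[R]_n * R) p : Prop :=
  let: (A, b, c) := q in
  if p is Some x then A * dot x x + dot b x + c = 0 else A = 0.

Lemma quadric_sphere_reflection (a : 'rV[R]_n) (r : R) q : 0 < r -> q != 0 ->
  exists2 q', q' != 0 &
    forall p, on_quadric q p -> on_quadric q' (sphere_reflection a r p).
Proof.
case: q => -[A b] c r0 q0.
(* the equation of the quadric in the coordinate [u = x - a] *)
pose b' := b + (2 * A) *: a.
pose c' := c + dot b a + A * dot a a.
(* if [v = (r ^+ 2 / |u| ^+ 2) *: u] is the image of [u], the equation in [u] is
   [c' |v| ^+ 2 + r ^+ 2 <b', v> + A r ^+ 4 = 0], expanded here in [v + a] *)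
exists (c', r ^+ 2 *: b' - (2 * c') *: a,
        c' * dot a a - r ^+ 2 * dot b' a + A * r ^+ 4).
  apply: contra q0 => /eqP[/[dup] c'0 -> +]; rewrite mulr0 scale0r subr0.
  move=> /eqP; rewrite scaler_eq0 sqrf_eq0 gt_eqF //= => /eqP b'0.
  rewrite b'0 dot0l mul0r mulr0 subr0 add0r => /eqP.
  rewrite mulf_eq0 expf_eq0 /= (gt_eqF r0) orbF => /eqP A0.
  move: b'0 c'0; rewrite /b' /c' A0 mulr0 scale0r addr0 => ->.
  by rewrite dot0l mul0r !addr0 => ->.
case=> [x|] /=; last by move=> ->; rewrite /c' /b' !dotE; ring.
case: eqP => [->|/eqP xa] /= qx; first by rewrite /c' -qx; ring.
rewrite sqr_enorm.
have u0 : dot (x - a) (x - a) != 0 by rewrite dot_eq0 subr_eq0.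
move: u0 qx; set u := x - a; have -> : x = u + a by rewrite subrK.
move: u => u u0; rewrite /c' /b' !dotE (dotC a u) => qx.
set d := dot u u in u0 qx *.
(* the new equation is [r ^+ 4 / |u| ^+ 2] times the old one *)
transitivity (r ^+ 4 / d * (A * (d + dot u a + (dot u a + dot a a)) +
   (dot b u + dot b a) + c)); last by rewrite qx mulr0.
by field.
Qed.

Lemma quadric_hyperplane_reflection (a : 'rV[R]_n) (t : R) q :
  a != 0 -> q != 0 ->
  exists2 q', q' != 0 &
    forall p, on_quadric q p -> on_quadric q' (hyperplane_reflection a t p).
Proof.
case: q => -[A b] c a0 q0.
have d0 : dot a a != 0 by rewrite dot_eq0.
(* the reflection is an involution: its composite with the old equation *)
exists (A, b - (2 * dot b a / dot a a + 4 * A * t / dot a a) *: a,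
        c + 2 * t * dot b a / dot a a + 4 * A * t ^+ 2 / dot a a).
  apply: contra q0 => /eqP[-> +]; rewrite mulr0 !mul0r !addr0.
  move=> /eqP; rewrite subr_eq0 => /eqP bE.
  (* [b] is twice its own projection to the line of [a], hence that is zero *)
  have /eqP : dot b a = 0.
    have : dot b a = 2 * dot b a.
      by rewrite [LHS](congr1 (fun z => dot z a) bE) dotZl divfK.
    lra.
  move=> /eqP ba; move: bE.
  by rewrite ba !(mulr0, mul0r, scale0r, addr0) => -> ->.
case=> [x|] //= qx; rewrite sqr_enorm -qx !dotE (dotC a x).
by field.
Qed.

Lemma quadric_mobius phi q : mobius phi -> q != 0 ->
  exists2 q', q' != 0 & forall p, on_quadric q p -> on_quadric q' (phi p).
Proof.
move=> phiP q0.
elim: phiP => [|a r psi r0 _ [q1 q10 IH]|a t psi a0 _ [q1 q10 IH]].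
- by exists q.
- have [q2 q20 H] := quadric_sphere_reflection a r0 q10.
  by exists q2 => // p /IH /H.
- have [q2 q20 H] := quadric_hyperplane_reflection t a0 q10.
  by exists q2 => // p /IH /H.
Qed.

End Quadric.

(** * Affine maps plus a sine and a cosine of one coordinate *)

Section Trig.
Variables (R : realType) (n m : nat) (i0 : 'I_n).
Implicit Types (A : 'M[R]_(n, m)) (c p q : 'rV[R]_m) (x v : 'rV[R]_n).

(** These maps form a class closed under partial derivatives, which contains the
    cylinder map and gives its smoothness at all orders at once. *)
Definition trig A c p q x : 'rV[R]_m :=
  x *m A + c + sin (x 0 i0) *: p + cos (x 0 i0) *: q.

Lemma is_diff_coord i x : is_diff x (fun y => y 0 i) (fun v => v 0 i).
Proof.
have lin : linear (fun v => v 0 i : R) by move=> a u v; rewrite !mxE.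
pose lM := GRing.isLinear.Build _ _ _ _ _ lin.
pose L : {linear 'rV[R]_n -> R} := HB.pack (fun v => v 0 i : R) lM.
apply: DiffDef; first exact: differentiable_coord.
exact: (@diff_lin _ _ _ L x (@coord_continuous R 1 n 0 i)).
Qed.

Lemma is_diff_mulmxr A x :
  is_diff x (fun y : 'rV[R]_n => y *m A) (fun v : 'rV[R]_n => v *m A).
Proof.
have d y : differentiable (fun z : 'rV[R]_n => z *m A) y.
  have -> : (fun z => z *m A) = \sum_i (fun z : 'rV[R]_n => z 0 i *: row i A).
    by apply/funext => z; rewrite fct_sumE mulmx_sum_row.
  by apply: differentiable_sum => i; apply/differentiableZl/differentiable_coord.
apply: DiffDef => //.
by apply: (@diff_lin _ _ _ (mulmxr A)) => y; exact/differentiable_continuous.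
Qed.

Lemma is_diff_coord_comp (h dh : R -> R) p x :
  is_derive (x 0 i0) 1 h (dh (x 0 i0)) ->
  is_diff x (fun y : 'rV[R]_n => h (y 0 i0) *: p)
    (fun v : 'rV[R]_n => (v 0 i0 * dh (x 0 i0)) *: p).
Proof.
move=> hd.
have dc := is_diff_coord i0 x.
have dh1 : differentiable h (x 0 i0).
  by apply/derivable1_diffP; exact: ex_derive.
have d : differentiable (h \o (fun y : 'rV[R]_n => y 0 i0)) x.
  by apply: differentiable_comp => //; exact: ex_diff.
apply: DiffDef; first exact: (differentiableZl p d).
rewrite (_ : 'd _ x =
  (fun v => 'd (h \o (fun y : 'rV[R]_n => y 0 i0)) x v *: p) :> (_ -> _));
  last exact: (diffZl p d).
apply/funext => v; congr (_ *: _).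
rewrite diff_comp //= diff_val deriv1E; last exact/derivable1_diffP.
by rewrite derive1E derive_val.
Qed.

Lemma is_diff_trig A c p q x :
  is_diff x (trig A c p q) (fun v => v *m A + 0
    + (v 0 i0 * cos (x 0 i0)) *: p + (v 0 i0 * - sin (x 0 i0)) *: q).
Proof.
have dA := is_diff_mulmxr A x.
have ds := @is_diff_coord_comp sin cos p x (is_derive_sin _).
have dc := @is_diff_coord_comp cos (fun t => - sin t) q x (is_derive_cos _).
exact: (is_diffD (is_diffD (is_diffD dA (is_diff_cst c x)) ds) dc).
Qed.

Lemma derive_trig i A c p q :
  'D_(delta_mx 0 i) (trig A c p q) =
  trig 0 (row i A) (- (i == i0)%:R *: q) ((i == i0)%:R *: p).
Proof.
apply/funext => x.
have d := is_diff_trig A c p q x.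
rewrite deriveE; last exact: ex_diff.
rewrite diff_val /trig mulmx0 add0r -rowE !mxE eqxx addr0 eq_sym.
by rewrite !scalerA mulrN mulrN (mulrC _ (cos _)) (mulrC _ (sin _)) addrAC.
Qed.

Lemma smooth_trig D A c p q : smooth D (trig A c p q).
Proof.
move=> s x _.
have [A' [c' [p' [q' ->]]]] : exists A' c' p' q',
    iter_partial s (trig A c p q) = trig A' c' p' q'.
  elim: s => [|i s [A' [c' [p' [q' /= ->]]]]]; first by exists A, c, p, q.
  by do 4 eexists; apply: derive_trig.
have d := is_diff_trig A' c' p' q' x.
split=> [|i]; first exact/differentiable_continuous/ex_diff.
exact/diff_derivable/ex_diff.
Qed.

End Trig.

(** * Chords of the unit circle *)

Section Chord.
Variable R : realType.
Implicit Types t s : R.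

Lemma sqr_sin_le t : sin t ^+ 2 <= t ^+ 2.
Proof.
wlog t0 : t / 0 <= t.
  move=> H; have [t0|/ltW t0] := leP 0 t; first exact: H t t0.
  by have := H (- t); rewrite sinN !sqrrN; apply; rewrite oppr_ge0.
have [c _] := MVT_segment t0 (fun x _ => is_derive_sin x)
  (continuous_subspaceT (@continuous_sin R)).
by rewrite sin0 !subr0 => ->; rewrite exprMn ler_piMl ?sqr_ge0.
Qed.

Lemma sqr_sin_ge t : t ^+ 2 - t ^+ 4 <= sin t ^+ 2.
Proof.
wlog t0 : t / 0 <= t.
  move=> H; have [t0|/ltW t0] := leP 0 t; first exact: H t t0.
  have := H (- t); rewrite sinN !sqrrN (_ : (- t) ^+ 4 = t ^+ 4); last by ring.
  by apply; rewrite oppr_ge0.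
have [c] := MVT_segment t0 (fun x _ => is_derive_sin x)
  (continuous_subspaceT (@continuous_sin R)).
rewrite in_itv /= => /andP[c0 ct]; rewrite sin0 !subr0 => ->.
rewrite exprMn cos2sin2 mulrBl mul1r lerB // -[4%N]/(2 + 2)%N exprD.
rewrite ler_wpM2r ?sqr_ge0 // (le_trans (sqr_sin_le c)) //.
by rewrite ler_sqr.
Qed.

Lemma chordE s t : (sin s - sin t) ^+ 2 + (cos s - cos t) ^+ 2 =
  4 * sin ((s - t) / 2) ^+ 2.
Proof.
have := cosD ((s - t) / 2) ((s - t) / 2); rewrite -splitr cosB => H.
have := cos2sin2 s; have := cos2sin2 t; have := cos2sin2 ((s - t) / 2).
nra.
Qed.

Lemma chord_le s t :
  (sin s - sin t) ^+ 2 + (cos s - cos t) ^+ 2 <= (s - t) ^+ 2.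
Proof. by rewrite chordE; have := sqr_sin_le ((s - t) / 2); lra. Qed.

Lemma chord_ge s t : (s - t) ^+ 2 - (s - t) ^+ 4 / 4 <=
  (sin s - sin t) ^+ 2 + (cos s - cos t) ^+ 2.
Proof. by rewrite chordE; have := sqr_sin_ge ((s - t) / 2); lra. Qed.

End Chord.

(** * The cylinder map *)

Section Cylinder.
Variables (R : realType) (n : nat) (i0 : 'I_n).
Implicit Types x y : 'rV[R]_n.

(** The map [x |-> (y, cos (x i0))], where [y] is [x] with [sin (x i0)] as its
    coordinate [i0]; see [cylinderE]. *)
Definition cylinder : 'rV[R]_n -> 'rV[R]_(n + 1) :=
  trig i0 (row_mx (1%:M - delta_mx i0 i0) 0) 0
    (row_mx (delta_mx 0 i0) 0) (row_mx 0 1%:M).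

(** The slab [|x i0| < pi / 2], on which the sine determines the angle. *)
Definition slab : set 'rV[R]_n := [set x | - (pi / 2) < x 0 i0 < pi / 2].

Lemma mulmx_delta x : x *m delta_mx i0 i0 = x 0 i0 *: delta_mx 0 i0.
Proof.
rewrite -(mul_delta_mx (0 : 'I_1)) mulmxA -colE [col _ _]mx11_scalar.
by rewrite mul_scalar_mx mxE.
Qed.

Lemma cylinderE x : cylinder x =
  row_mx (x + (sin (x 0 i0) - x 0 i0) *: delta_mx 0 i0) (cos (x 0 i0))%:M.
Proof.
rewrite /cylinder /trig addr0 mul_mx_row !scale_row_mx !add_row_mx.
rewrite !(mulmx0, scaler0, addr0, add0r) scalemx1 mulmxBr mulmx1; congr row_mx.
by rewrite mulmx_delta scalerBl addrAC addrA.
Qed.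

Lemma sqr_enorm_cylinderB x y :
  enorm (cylinder x - cylinder y) ^+ 2 =
  enorm (x - y) ^+ 2 - (x 0 i0 - y 0 i0) ^+ 2 +
    ((sin (x 0 i0) - sin (y 0 i0)) ^+ 2 + (cos (x 0 i0) - cos (y 0 i0)) ^+ 2).
Proof.
rewrite !sqr_enorm !cylinderE opp_row_mx add_row_mx dot_row_mx.
set a := x 0 i0; set b := y 0 i0.
have -> : x + (sin a - a) *: delta_mx 0 i0 - (y + (sin b - b) *: delta_mx 0 i0)
   = (x - y) + ((sin a - a) - (sin b - b)) *: delta_mx 0 i0.
  by rewrite [_ *: _ in RHS]scalerBl opprD addrACA.
rewrite dot_add_delta -raddfB dot_scalar_mx !mxE -/a -/b.
ring.
Qed.

Lemma enorm_cylinderB_le x y : enorm (cylinder x - cylinder y) <= enorm (x - y).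
Proof.
rewrite -(@ler_pXn2r _ 2) ?nnegrE ?enorm_ge0 // sqr_enorm_cylinderB.
have := chord_le (x 0 i0) (y 0 i0); lra.
Qed.

Lemma enorm_cylinderB_ge x y : enorm (x - y) <= 2 ->
  enorm (x - y) * (1 - enorm (x - y) ^+ 2 / 4) <=
  enorm (cylinder x - cylinder y).
Proof.
set r := enorm (x - y) => r2.
have r0 : 0 <= r by exact: enorm_ge0.
have c0 : 0 <= 1 - r ^+ 2 / 4 by nra.
have c1 : 1 - r ^+ 2 / 4 <= 1 by nra.
rewrite -(@ler_pXn2r _ 2) ?nnegrE ?enorm_ge0 ?mulr_ge0 // sqr_enorm_cylinderB.
have := chord_ge (x 0 i0) (y 0 i0).
have : (x 0 i0 - y 0 i0) ^+ 2 <= r ^+ 2.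
  by have := sqr_coord_le (x - y) i0; rewrite !mxE sqr_enorm.
rewrite -/r; set t := _ - _ => tr H.
have t4 : t ^+ 4 <= r ^+ 4.
  by rewrite -[4%N]/(2 * 2)%N !exprM ler_pXn2r ?nnegrE ?sqr_ge0.
apply: (@le_trans _ _ (r ^+ 2 * (1 - r ^+ 2 / 4))); last by lra.
rewrite exprMn ler_wpM2l ?sqr_ge0 // expr2 ler_piMl //.
Qed.

Lemma open_slab : open slab.
Proof.
have -> : slab = (fun x => x 0 i0) @^-1` `]- (pi / 2), pi / 2[.
  by apply/seteqP; split=> x; rewrite /slab /= in_itv.
by apply: open_comp => [x _|]; [exact: coord_continuous | exact: interval_open].
Qed.

Lemma domain_slab : domain slab.
Proof.
have pi0 := @pi_gt0 R.
have D0 : slab 0 by rewrite /slab /= mxE; lra.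
split; [exact: open_slab | | by exists 0].
(* the slab is star-shaped around the origin *)
have -> : slab = \bigcup_(x in slab) ((fun t => t *: x) @` `[0 : R, 1]).
  apply/seteqP; split=> [x Dx|_ [x Dx [t t01 <-]]].
    exists x => //; exists 1; last by rewrite scale1r.
    by rewrite /= in_itv /= ler01 lexx.
  move: Dx t01; rewrite /slab /= in_itv /= mxE => /andP[? ?] /andP[? ?].
  by apply/andP; split; nra.
apply: bigcup_connected => [|x Dx].
  exists 0 => x Dx; exists 0; last by rewrite scale0r.
  by rewrite /= in_itv /= lexx ler01.
apply: connected_continuous_connected; first exact: segment_connected.
apply: continuous_subspaceT; exact: scalel_continuous.
Qed.

Lemma sin_slab x : slab x -> -1 < sin (x 0 i0) < 1.
Proof.
move=> /cos_gt0_pihalf c0; have := cos2sin2 (x 0 i0).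
by move=> H; apply/andP; split; nra.
Qed.

Lemma embedding_cylinder : embedding slab cylinder.
Proof.
split.
  apply: continuous_subspaceT => x.
  have sm : smooth setT cylinder by exact: smooth_trig.
  by have [] := sm [::] x I.
pose u (y : 'rV[R]_(n + 1)) := lsubmx y : 'rV[R]_n.
exists (fun z : 'rV[R]_(n + 1) =>
  u z + (asin (u z 0 i0) - u z 0 i0) *: delta_mx 0 i0); split.
  apply: continuous_in_subspaceT => _ /set_mem[x Dx <-].
  set w := cylinder x.
  have uc : {for w, continuous u}.
    exact/differentiable_continuous/differentiable_lsubmx.
  have uw : u w 0 i0 = sin (x 0 i0).
    by rewrite /u /w cylinderE row_mxKl !mxE !eqxx /= mulr1 addrC subrK.
  have cc : {for w, continuous (fun z => u z 0 i0)}.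
    exact: (continuous_comp uc (@coord_continuous _ _ _ _ _ _)).
  apply: continuousD => //; apply: continuousZl.
  apply: continuousB => //; apply: (continuous_comp cc).
  by apply: continuous_asin; rewrite uw sin_slab.
move=> x Dx; rewrite /u cylinderE row_mxKl !mxE !eqxx /= mulr1 addrC addrNK.
rewrite sinK; last by case/andP: Dx => ? ?; rewrite in_itv /= !ltW.
rewrite addrAC -addrA -scalerDl.
by rewrite addrA addrNK subrr scale0r addr0.
Qed.

Lemma smooth_embedding_cylinder : smooth_embedding slab cylinder.
Proof.
split; [exact: embedding_cylinder | exact: smooth_trig | move=> x Dx].
have d := is_diff_trig i0 (row_mx (1%:M - delta_mx i0 i0) 0) 0
    (row_mx (delta_mx 0 i0) 0) (row_mx 0 1%:M) x.
split; first exact: ex_diff.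
have dE := @diff_val _ _ _ _ _ _ _ d.
apply: raddf_inj => v; rewrite [X in X = 0 -> _](congr1 (fun g => g v) dE).
rewrite addr0 mul_mx_row !scale_row_mx !add_row_mx.
rewrite !(mulmx0, scaler0, addr0, add0r) scalemx1 mulmxBr mulmx1.
rewrite mulmx_delta -[RHS in _ = RHS -> _]row_mx0 => /eq_row_mx[v0 _].
(* the coordinate [i0] of [v0], where the cosine does not vanish *)
have v0i : v 0 i0 * cos (x 0 i0) = 0.
  move/matrixP/(_ 0 i0): v0.
  by rewrite !mxE !eqxx /= !mulr1 subrr add0r.
have /gt_eqF c0 := cos_gt0_pihalf Dx.
have vi0 : v 0 i0 = 0 by apply/eqP; move/eqP: v0i; rewrite mulf_eq0 c0 orbF.
by move: v0; rewrite vi0 mul0r !scale0r subr0 addr0.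
Qed.

Lemma one_quasiconformal_cylinder : one_quasiconformal slab cylinder.
Proof.
move=> x Dx; apply/lee_addgt0Pr => e e0.
(* for [r < d] the quotient is at most [(1 - r ^+ 2 / 4)^-1 <= 1 + e] *)
pose d := Num.min 1 e.
have d0 : 0 < d by rewrite lt_min ltr01.
apply: ge_ereal_inf; eexists; first exists [set r | 0 < r < d]; [|reflexivity|].
  near=> r; apply/andP; split; near: r; first exact: nbhs_right_gt.
  exact: nbhs_right_lt.
apply: ge_ereal_sup => _ [r /= /andP[r0]] /[swap] <-.
rewrite /d lt_min => /andP[r1 re].
set c := 1 - r ^+ 2 / 4.
have c0 : 0 < c by rewrite /c; nra.
have rc : (0 <= (r * c)%:E)%E by rewrite lee_fin mulr_ge0 ?ltW.
have supr : (ereal_sup (dist_on_sphere slab cylinder x r) <= r%:E)%E.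
  apply: ge_ereal_sup => _ [y [_ xy] <-].
  by rewrite lee_fin -xy enorm_cylinderB_le.
have infr : ((r * c)%:E <= ereal_inf (dist_on_sphere slab cylinder x r))%E.
  apply: le_ereal_inf_tmp => _ [y [_ xy] <-].
  by rewrite lee_fin /c -xy enorm_cylinderB_ge // xy; lra.
have inf0 := le_trans rc infr.
apply: (le_trans (lee_wpmul2r _ supr)); first by rewrite inve_ge0.
apply: (@le_trans _ _ (r%:E * ((r * c)%:E)^-1)%E).
  apply: lee_wpmul2l; first by rewrite lee_fin ltW.
  by rewrite lee_pV2.
rewrite inver gt_eqF ?mulr_gt0 // -EFinM -EFinD lee_fin.
rewrite invfM mulrA divff ?gt_eqF // mul1r -[_^-1]mul1r ler_pdivrMr //.
have r2 : r ^+ 2 <= e by nra.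
have r2' : r ^+ 2 <= 1 by nra.
rewrite /c; nra.
Unshelve. all: by end_near.
Qed.

(** No equation other than the trivial one holds on the whole image of the slab;
    the coordinate [j] is one along which the cylinder is straight. *)
Lemma cylinder_not_in_quadric (j : 'I_n) (q : R * 'rV[R]_(n + 1) * R) :
  j != i0 -> (forall x, slab x -> on_quadric q (Some (cylinder x))) -> q = 0.
Proof.
case: q => -[A b] c ji H.
have pi0 := @pi_gt0 R.
have [b1 [b2 bE]] : exists (b1 : 'rV[R]_n) (b2 : R), b = row_mx b1 b2%:M.
  by exists (lsubmx b), (rsubmx b 0 0); rewrite -mx11_scalar hsubmxK.
rewrite {}bE in H *.
(* the equation of the generalized sphere along the cylinder *)
have E x : slab x -> A * (dot x x - x 0 i0 ^+ 2 + 1) + dot b1 x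
    + (sin (x 0 i0) - x 0 i0) * b1 0 i0 + cos (x 0 i0) * b2 + c = 0.
  move=> /H; rewrite /= cylinderE !dot_row_mx dot_add_delta.
  rewrite dotDr dotZr dot_delta !dot_scalar_mx.
  rewrite -[cos _ * cos _]expr2 cos2sin2 => <-.
  ring.
have b12 : A + b2 + c = 0.
  have := E 0; rewrite /slab /= (dotC b1) !dot0l !mxE sin0 cos0 => E0.
  have /E0 : - (pi / 2) < (0 : R) < pi / 2 by lra.
  lra.
have Ei i s : i != i0 -> A * s ^+ 2 + b1 0 i * s = 0.
  move=> ii; have := E (s *: delta_mx 0 i).
  rewrite /slab /= !mxE eqxx eq_sym (negPf ii) mulr0 sin0 cos0 !dotE !dot_delta.
  rewrite !mxE !eqxx /= => E0.
  have /E0 : - (pi / 2) < (0 : R) < pi / 2 by lra.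
  lra.
have A0 : A = 0 by have := Ei j 1 ji; have := Ei j (-1) ji; lra.
have b1i i : i != i0 -> b1 0 i = 0.
  by move=> ii; have := Ei i 1 ii; rewrite A0; lra.
have Et t : - (pi / 2) < t < pi / 2 -> sin t * b1 0 i0 + (cos t - 1) * b2 = 0.
  move=> tpi; have := E (t *: delta_mx 0 i0).
  rewrite /slab /= !mxE !eqxx mulr1 !dotE !dot_delta => /(_ tpi).
  rewrite A0 in b12 *; lra.
(* an angle of the slab with [sin t != 0], hence [cos t != 1] *)
pose t : R := pi / 3.
have s0 : 0 < sin t by apply: sin_gt0_pi; rewrite /t; lra.
have := Et t; have := Et (- t); rewrite sinN cosN => E1 E2.
have {}E1 := E1 ltac:(rewrite /t; lra); have {}E2 := E2 ltac:(rewrite /t; lra).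
have b10 : b1 0 i0 = 0.
  have /eqP : sin t * b1 0 i0 = 0 by lra.
  by rewrite mulf_eq0 (gt_eqF s0) /= => /eqP.
have b20 : b2 = 0.
  have /eqP : (cos t - 1) * b2 = 0 by lra.
  rewrite mulf_eq0 subr_eq0 => /orP[/eqP ct|/eqP //].
  by have := cos2sin2 t; rewrite ct; nra.
have -> : b1 = 0.
  by apply/rowP => i; rewrite mxE; have [->|/b1i] := eqVneq i i0.
rewrite b20 raddf0 row_mx0.
by move: b12; rewrite A0 b20 !add0r => ->.
Qed.

End Cylinder.

Lemma cylinder_not_mobius (R : realType) (n : nat) (i0 j : 'I_n) : j != i0 ->
  ~ restriction_of_mobius (@slab R n i0) (cylinder i0).
Proof.
move=> ji [phi [phiM phiE]].
(* [R^n x {0}] has equation [<e, x> = 0], with [e] the last basis vector *)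
pose e : 'rV[R]_(n + 1) := delta_mx 0 (rshift n 0).
have q0 : ((0, e, 0) : R * 'rV[R]_(n + 1) * R) != 0.
  apply/eqP => -[/matrixP/(_ 0 (rshift n 0))]; rewrite !mxE !eqxx /=.
  by move/eqP; rewrite oner_eq0.
have [q /eqP q'0 qP] := quadric_mobius phiM q0.
apply: q'0; apply: (cylinder_not_in_quadric ji) => x Dx.
rewrite -(phiE x Dx); apply: qP => /=.
by rewrite mul0r addr0 add0r dotC dot_delta row_mxEr mxE.
Qed.

Theorem mainTheorem3 (R : realType) (n : nat) (hn : (3 <= n)%N) :
  exists (D : set 'rV[R]_n) (f : 'rV[R]_n -> 'rV[R]_(n + 1)),
    [/\ domain D,
        smooth_embedding D f,
        one_quasiconformal D f
      & ~ restriction_of_mobius D f].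
Proof.
have n0 : (0 < n)%N by exact: leq_trans hn.
have n1 : (1 < n)%N by exact: leq_trans hn.
pose i0 := Ordinal n0.
exists (slab i0), (cylinder i0); split.
- exact: domain_slab.
- exact: smooth_embedding_cylinder.
- exact: one_quasiconformal_cylinder.
- exact: (@cylinder_not_mobius _ _ i0 (Ordinal n1)).
Qed.
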